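(* Let $d\ge 1$ and $N\ge 1$ be integers. Assume that $P_1,\ldots,P_N\in\mathbb C[z_1,\ldots,z_d]$ are nonzero homogeneous polynomials and $\delta_1,\ldots,\delta_N>0$ are real numbers such that \[ \sum_{k=1}^N \delta_k^2\deg P_k\le 1. \] Let $p$ be any point of the unit sphere $S^{2d-1}\subset\mathbb C^d$ at which the absolute value of $P_1^{\delta_1^2}\cdots P_N^{\delta_N^2}$, i.e. the function $|P_1|^{\delta_1^2}\cdots|P_N|^{\delta_N^2}$, attains its maximum on $S^{2d-1}$. Then, for every $k=1,\ldots,N$, the point $p$ is at angular distance at least $\arcsin\delta_k$ from the intersection of the zero set of $P_k$ with $S^{2d-1}$.
   Context: $S^{2d-1}=\{z\in\mathbb C^d : |z_1|^2+\cdots+|z_d|^2=1\}$. The angular distance between $u,v\in S^{2d-1}$ is the angle between them as unit vectors of $\mathbb C^d\cong\mathbb R^{2d}$, i.e. $\arccos\left(\mathrm{Re}\sum_j u_j\overline{v_j}\right)\in[0,\pi]$. ''The point $p$ is at angular distance at least $r$ from a set $Z$'' means that every $z\in Z$ is at angular distance at least $r$ from $p$; it is vacuously true if $Z$ is empty, in particular when $P_k$ is a nonzero constant (if $\deg P_k\ge 1$, the hypothesis gives $\delta_k\le 1$, so $\arcsin\delta_k$ is defined). *)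

(* Defs.v *)
From HB Require Import structures.
From mathcomp Require Import all_boot all_order all_algebra.
From mathcomp Require Import classical_sets reals exp trigo.
From mathcomp Require Import complex.
From mathcomp Require Import mpoly.

Set Implicit Arguments.
Unset Strict Implicit.
Unset Printing Implicit Defensive.

Import Order.TTheory GRing.Theory Num.Theory.

Local Open Scope classical_set_scope.
Local Open Scope ring_scope.

(* [msize] is one more than the total degree of a nonzero polynomial. *)
Definition total_degree (R : realType) (d : nat) (P : {mpoly R[i][d]}) : nat :=
  (msize P).-1.

(* The norm [`|x|] of a complex [x] lives in [R[i]]; [normc x] is the same
   modulus as an element of [R]. *)
Notation cmod := Normc.normc.

Definition unit_sphere (R : realType) (d : nat) : set 'rV[R[i]]_d :=
  [set z | \sum_(j < d) cmod (z 0 j) ^+ 2 = 1].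

Definition zero_set (R : realType) (d : nat) (P : {mpoly R[i][d]}) :
    set 'rV[R[i]]_d :=
  [set z | P.@[z 0] = 0].

Definition angular_distance (R : realType) (d : nat)
    (u v : 'rV[R[i]]_d) : R :=
  acos (complex.Re (\sum_(j < d) u 0 j * conjc (v 0 j))).

Definition angular_distance_ge (R : realType) (d : nat) (r : R)
    (p : 'rV[R[i]]_d) (Z : set 'rV[R[i]]_d) : Prop :=
  forall z, Z z -> r <= angular_distance p z.

Definition weighted_modulus (R : realType) (d N : nat)
    (P : 'I_N -> {mpoly R[i][d]}) (delta : 'I_N -> R) (z : 'rV[R[i]]_d) : R :=
  \prod_(k < N) cmod (P k).@[z 0] `^ (delta k ^+ 2).

Definition attains_max_on (R : realType) (T : Type) (f : T -> R) (A : set T)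
    (p : T) : Prop :=
  A p /\ forall z, A z -> f z <= f p.

(* Main.v *)
Require Import Defs.
From HB Require Import structures.
From mathcomp Require Import all_boot all_order all_algebra.
From mathcomp Require Import cyclotomic cyclic separable.
From mathcomp Require Import classical_sets reals exp trigo.
From mathcomp Require Import complex.
From mathcomp Require Import mpoly.
From mathcomp Require Import ring lra.

Set Implicit Arguments.
Unset Strict Implicit.
Unset Printing Implicit Defensive.

Import Order.TTheory GRing.Theory Num.Theory.

Local Open Scope classical_set_scope.
Local Open Scope ring_scope.

(** Let [q] be a zero of [P k] on the sphere, let [c] be the Hermitian product
    of [p] and [q], and write [a_j = delta j ^+ 2]. It suffices to prove
    [a_k <= 1 - |c|^2]: the real part of [c] is at most [|c|], and taking
    [asin] of [delta k] on one side and [acos] of the real part of [c] on the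
    other gives the claim.

    Put [e = p - c q], which is orthogonal to [q], and move along the complex
    line [z(w) = c q + w e]; then [z(1) = p] and
    [|z(w)|^2 = 1 + (|w|^2 - 1) (1 - |c|^2)]. Each [P j] restricts to a
    polynomial [f_j] in [w], and [f_k] vanishes at [0] because [P k] is
    homogeneous and vanishes at [q], so [f_k = w g]. Let [h_j] be [f_j] for
    [j != k] and [g] for [j = k]. Homogeneity and the maximality of [p] bound
    the weighted modulus [W] at every nonzero [z] by [|z|^D W(p)], where
    [D <= 1] is the weighted degree. So for [|w| = r > 1],
    [[
      r^(a_k) \prod_j |h_j(w)|^(a_j) = W(z(w)) <= |z(w)|^D W(p),
    ]]
    whereas at [w = 1] the product of the [|h_j|^(a_j)] is [W(p)]. By the
    maximum principle for such products ([max_principle_prod_powR]) the bound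
    on the circle of radius [r] also holds at [1]; dividing by [W(p) > 0]
    leaves [r^(a_k) <= |z(w)|^D <= |z(w)|]. With [t = r^2] this says
    [t^(a_k) <= 1 + (t - 1) (1 - |c|^2)] for all [t > 1]: comparing slopes at
    [t = 1] gives [a_k <= 1 - |c|^2] ([powR_tangent]).

    The maximum principle is reduced to polynomials. For a single polynomial,
    Cauchy's coefficient bounds give the principle up to a factor depending
    only on the radii ([horner_disc_bound]). Applied to
    [\prod_j h_j ^ m_j] with [m_j] the integer just above [n a_j], this gives
    the principle for the [n]-th power of the real-exponent product, up to a
    factor independent of [n], which disappears as [n] grows. *)

(** * Polynomials on a disc *)

Lemma exists_primitive_root (C : numClosedFieldType) (n : nat) :
  (0 < n)%N -> exists z : C, n.-primitive_root z.
Proof.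
move=> n_gt0; pose p : {poly C} := 'X^n - 1.
have [rs Dp] := closed_field_poly_normal p.
have p_monic : p \is monic by rewrite monicXnsubC.
rewrite (monicP p_monic) scale1r in Dp.
have rs_roots : all n.-unity_root rs.
  by apply/allP => z; rewrite -root_prod_XsubC -Dp.
have rs_uniq : uniq rs.
  by rewrite -separable_prod_XsubC -Dp separable_Xn_sub_1 // pnatr_eq0 -lt0n.
have rs_size : (n <= size rs)%N.
  by rewrite -ltnS -(size_prod_XsubC rs id) -Dp size_XnsubC.
have /hasP[z _ prim_z] := has_prim_root n_gt0 rs_roots rs_uniq rs_size.
by exists z.
Qed.

(** Orthogonality of the characters of a finite cyclic group: the discrete
    substitute for integrating over a circle. *)
Lemma sum_prim_root_expr (F : fieldType) (n : nat) (z : F) (j k : 'I_n) :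
  n.-primitive_root z ->
  \sum_(l < n) (z ^+ l) ^+ j * (z ^+ l) ^- k = n%:R *+ (j == k).
Proof.
move=> prim_z.
have z_neq0 : z != 0.
  rewrite -unitfE -(unitrX_pos _ (prim_order_gt0 prim_z)).
  by rewrite (prim_expr_order prim_z) unitr1.
pose x := z ^+ j / z ^+ k.
have -> : \sum_(l < n) (z ^+ l) ^+ j * (z ^+ l) ^- k = \sum_(l < n) x ^+ l.
  apply: eq_bigr => l _.
  by rewrite /x exprMn exprVn -!exprM ![(l * _)%N]mulnC.
have [jk|jk] := eqVneq j k.
  rewrite /x jk divff ?expf_neq0 //.
  by under eq_bigr do rewrite expr1n; rewrite sumr_const card_ord mulr1n.
have x_neq1 : x - 1 != 0.
  apply/eqP => /subr0_eq /(canRL (mulfVK (expf_neq0 k z_neq0))) /eqP.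
  by rewrite mul1r (eq_prim_root_expr prim_z) !modn_small // val_eqE (negPf jk).
apply: (mulfI x_neq1); rewrite -subrX1 mulr0n mulr0.
rewrite /x exprMn exprVn -!exprM ![(_ * n)%N]mulnC !exprM.
by rewrite (prim_expr_order prim_z) !expr1n invr1 mulr1 subrr.
Qed.

(** The coefficient of degree [k] is, up to the factor [r ^+ k], the average of
    [f.[w] * (w / r) ^- k] over the points [w = r * z ^+ l] of the circle,
    where [z] is a root of unity of order exceeding the degree of [f]. *)
Lemma cauchy_coef_bound (C : numClosedFieldType) (f : {poly C}) (r M : C) :
    0 < r -> (forall w, `|w| = r -> `|f.[w]| <= M) ->
  forall k, `|f`_k| * r ^+ k <= M.
Proof.
move=> r_gt0 fM k.
have M_ge0 : 0 <= M by apply: le_trans (fM r (gtr0_norm r_gt0)).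
have [kf|kf] := ltnP k (size f); last by rewrite nth_default // normr0 mul0r.
pose n := size f; pose kk := Ordinal kf : 'I_n.
have n_gt0 : (0 < n)%N by apply: leq_trans (kf).
have [z prim_z] := exists_primitive_root C n_gt0.
have z1 : `|z| = 1.
  apply/eqP; rewrite -(@pexpr_eq1 _ _ n) ?n_gt0 //.
  by rewrite -normrX (prim_expr_order prim_z) normr1.
have E : n%:R * (f`_k * r ^+ k)
       = \sum_(l < n) f.[r * z ^+ l] * (z ^+ l) ^- k.
  under eq_bigr => l _ do rewrite horner_coef mulr_suml.
  rewrite exchange_big /=.
  under eq_bigr => j _.
    under eq_bigr => l _ do
      rewrite exprMn mulrA -(mulrA (f`_j * _)).
    rewrite -mulr_sumr (sum_prim_root_expr j kk prim_z).
    over.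
  rewrite (bigD1 kk) //= big1 ?addr0 => [|j /negPf ->]; last first.
    by rewrite mulr0n mulr0.
  by rewrite eqxx mulr1n mulrC.
rewrite -(ler_pM2l (_ : 0 < n%:R)) ?ltr0n //.
rewrite -(ger0_norm (ltW (exprn_gt0 k r_gt0))).
rewrite -normrM -[X in X * `|_|](ger0_norm (ler0n C n)) -normrM E.
apply: le_trans (ler_norm_sum _ _ _) _.
rewrite mulr_natl -[n in X in _ <= X]card_ord -sumr_const.
apply: ler_sum => l _.
by rewrite normrM normfV !normrX z1 !expr1n invr1 mulr1 fM // normrM normrX z1
  expr1n mulr1 gtr0_norm.
Qed.

(** A weak maximum principle, obtained by summing the coefficient bounds against
    a geometric series. The factor [1 - `|w0| / r] is lossy but does not depend
    on [f], so it can be removed by applying the bound to powers. *)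
Lemma horner_disc_bound (C : numClosedFieldType) (f : {poly C}) (r M w0 : C) :
    `|w0| < r -> (forall w, `|w| = r -> `|f.[w]| <= M) ->
  `|f.[w0]| * (1 - `|w0| / r) <= M.
Proof.
move=> w0r fM; have r_gt0 : 0 < r by apply: le_lt_trans w0r.
have M_ge0 : 0 <= M by apply: le_trans (fM r (gtr0_norm r_gt0)).
set q := `|w0| / r.
have q_ge0 : 0 <= q by rewrite divr_ge0 // ltW.
have q1 : 0 <= 1 - q by rewrite subr_ge0 ltW // ltr_pdivrMr // mul1r.
have fq : `|f.[w0]| <= M * \sum_(i < size f) q ^+ i.
  rewrite horner_coef; apply: le_trans (ler_norm_sum _ _ _) _.
  rewrite mulr_sumr; apply: ler_sum => i _.
  rewrite normrM normrX (_ : _ * _ = `|f`_i| * r ^+ i * q ^+ i); last first.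
    by rewrite -mulrA -exprMn mulrC [r * _]mulrC mulfVK ?gt_eqF // mulrC.
  by rewrite ler_wpM2r ?exprn_ge0 // cauchy_coef_bound.
apply: le_trans (ler_wpM2r q1 fq) _.
rewrite -mulrA ler_piMr // mulrC -opprB mulNr -subrX1 opprB.
by rewrite lerBlDr lerDl exprn_ge0.
Qed.

(** * The modulus as a real number *)

Section Modulus.
Variable R : realType.
Implicit Types x y : R[i].

Lemma normE x : `|x| = (cmod x)%:C%C.
Proof. by []. Qed.

Lemma cmod_ge0 x : 0 <= cmod x.
Proof. by case: x => a b; rewrite sqrtr_ge0. Qed.

Lemma cmod_real (a : R) : cmod a%:C%C = `|a|.
Proof. by rewrite /= expr0n /= addr0 sqrtr_sqr. Qed.

Lemma cmod_eq0 x : (cmod x == 0) = (x == 0).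
Proof.
by apply/eqP/eqP => [/Normc.eq0_normc|->] //; rewrite Normc.normc0.
Qed.

Lemma cmodX x n : cmod (x ^+ n) = cmod x ^+ n.
Proof.
by elim: n => [|n IHn]; rewrite ?Normc.normc1 // !exprS Normc.normcM IHn.
Qed.

Lemma cmod_prod I (s : seq I) (P : pred I) (F : I -> R[i]) :
  cmod (\prod_(i <- s | P i) F i) = \prod_(i <- s | P i) cmod (F i).
Proof. exact: (big_morph _ (@Normc.normcM R) (Normc.normc1 R)). Qed.

Lemma cmod_sqr x : (cmod x ^+ 2)%:C%C = x * x^*%C.
Proof. by rewrite rmorphXn /= -normE sqr_normc. Qed.

End Modulus.

(** * The maximum principle with real exponents *)

Section MaximumPrinciple.
Variable R : realType.

Lemma cmod_horner_le (f : {poly R[i]}) (w : R[i]) :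
  cmod f.[w] <= \sum_(i < size f) cmod f`_i * cmod w ^+ i.
Proof.
rewrite -lecR -normE horner_coef rmorph_sum /=.
apply: le_trans (ler_norm_sum _ _ _) _; apply: ler_sum => i _.
by rewrite normrM normrX !normE -rmorphXn -rmorphM.
Qed.

(** Replacing a real exponent by the next natural number costs a factor
    [x `^ s] with [0 <= s <= 1], which lies between [1] and [x]. Since [m] is
    positive the bounds hold also for [x = 0], even when [t = 0]. *)
Lemma powR_next_nat (x t : R) (m := (Num.truncn t).+1) : 0 <= x -> 0 <= t ->
  Num.min 1 x * x `^ t <= x ^+ m <= Num.max 1 x * x `^ t.
Proof.
move=> x_ge0 t_ge0; have /andP[tm1 tm2] := truncn_itv t_ge0.
move: x_ge0; rewrite le0r => /predU1P[->|x_gt0].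
  rewrite expr0n /= min_r // mul0r lexx /=.
  by rewrite mulr_ge0 ?powR_ge0 // le_max ler01.
pose s : R := m%:R - t.
have s_ge0 : 0 <= s by rewrite subr_ge0 ltW.
have s_le1 : s <= 1 by rewrite /s /m -natr1; lra.
have -> : x ^+ m = x `^ s * x `^ t.
  rewrite -powRD; last by rewrite (gt_eqF x_gt0) implybT.
  by rewrite /s subrK powR_mulrn // ltW.
rewrite !ler_wpM2r ?powR_ge0 //.
- have [x1|x1] := lerP x 1.
    have x01 : 0 < x <= 1 by rewrite x_gt0.
    by rewrite -(powRr0 x) ger_powR.
  by rewrite ler1_powR // ltW.
have [x1|x1] := lerP x 1.
  have x01 : 0 < x <= 1 by rewrite x_gt0.
  by rewrite ger1_powR.
by rewrite -(powRr0 x) ler_powR // ltW.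
Qed.

(** If [0 < S < V], then [(V / S) ^+ n] grows at least linearly in [n] by
    Bernoulli's inequality, yet it stays below [K / c]. *)
Lemma le_of_geometric_bound (V S c K : R) : 0 <= V -> 0 <= S -> 0 < c ->
  (forall n, c * V ^+ n <= K * S ^+ n) -> V <= S.
Proof.
move=> V_ge0 S_ge0 c_gt0 VS; rewrite leNgt; apply/negP => SV.
move: S_ge0; rewrite le0r => /predU1P[S0|S_gt0].
  have := VS 1%N; rewrite !expr1 S0 mulr0 leNgt => /negP; apply.
  by rewrite mulr_gt0 // -S0.
pose e := V / S - 1.
have e_gt0 : 0 < e by rewrite subr_gt0 ltr_pdivlMr // mul1r.
have bern n : 1 + n%:R * e <= (V / S) ^+ n.
  elim: n => [|n IHn]; first by rewrite mul0r addr0 expr0.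
  have -> : V / S = 1 + e by rewrite /e; ring.
  rewrite exprS -natr1.
  have := ler_wpM2l (ltW (addr_gt0 ltr01 e_gt0)) IHn.
  have -> : V / S = 1 + e by rewrite /e; ring.
  have : 0 <= n%:R * e * e by rewrite !mulr_ge0 // ltW.
  lra.
have K_ge n : c * (1 + n%:R * e) <= K.
  apply: le_trans (_ : c * (V / S) ^+ n <= _); first by rewrite ler_pM2l.
  by rewrite expr_div_n mulrA ler_pdivrMr ?exprn_gt0.
have K_gt0 : 0 < K by apply: lt_le_trans (K_ge 0%N); rewrite mul0r addr0 mulr1.
have := archi_boundP (divr_ge0 (ltW K_gt0) (ltW (mulr_gt0 c_gt0 e_gt0))).
set n := Num.bound _; rewrite ltr_pdivrMr ?mulr_gt0 //.
have := K_ge n; lra.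
Qed.

(** The value at [w0] and the bound on the circle are compared after raising to
    the [n]-th power and rounding the exponents [n a_k] up to naturals. The
    rounding loses the factors [min 1 |g_k(w0)|] and [B k], and
    [horner_disc_bound] loses [1 - |w0| / r]; none depends on [n]. *)
Lemma max_principle_prod_powR (N : nat) (g : 'I_N -> {poly R[i]})
    (a : 'I_N -> R) (r S : R) (w0 : R[i]) :
    (forall k, 0 < a k) -> cmod w0 < r ->
    (forall w, cmod w = r -> \prod_k cmod (g k).[w] `^ a k <= S) ->
  \prod_k cmod (g k).[w0] `^ a k <= S.
Proof.
move=> a_gt0 w0r gS.
have r_gt0 : 0 < r by apply: le_lt_trans (cmod_ge0 w0) w0r.
set V := \prod_k _.
have V_ge0 : 0 <= V by apply: prodr_ge0 => k _; apply: powR_ge0.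
have S_ge0 : 0 <= S.
  apply: le_trans (gS r%:C%C _); last by rewrite cmod_real gtr0_norm.
  by apply: prodr_ge0 => k _; apply: powR_ge0.
have [V0|V_neq0] := eqVneq V 0; first by rewrite V0.
pose B k := 1 + \sum_(i < size (g k)) cmod (g k)`_i * r ^+ i.
have B_ge1 k : 1 <= B k.
  rewrite lerDl sumr_ge0 // => i _.
  by rewrite mulr_ge0 ?cmod_ge0 // exprn_ge0 // ltW.
have gB k w : cmod w = r -> cmod (g k).[w] <= B k.
  by move=> wr; rewrite /B -wr; apply: ler_wpDl => //; apply: cmod_horner_le.
pose c := (1 - cmod w0 / r) * \prod_k Num.min 1 (cmod (g k).[w0]).
have w0r1 : 0 < 1 - cmod w0 / r by rewrite subr_gt0 ltr_pdivrMr // mul1r.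
have c_gt0 : 0 < c.
  rewrite mulr_gt0 //; apply: prodr_gt0 => k _.
  rewrite lt_min ltr01 lt0r cmod_ge0 andbT /=.
  apply: contra V_neq0 => /eqP gk0; apply/eqP; rewrite /V (bigD1 k) //= gk0.
  by rewrite powR0 ?mul0r // gt_eqF.
pose m n k := (Num.truncn (n%:R * a k)).+1.
have na_ge0 n k : 0 <= n%:R * a k by rewrite mulr_ge0 // ltW.
have prodE n w : (\prod_k cmod (g k).[w] `^ a k) ^+ n
               = \prod_k cmod (g k).[w] `^ (n%:R * a k).
  rewrite -prodrXl; apply: eq_bigr => k _.
  by rewrite -powR_mulrn ?powR_ge0 // -powRrM mulrC.
apply: (le_of_geometric_bound V_ge0 S_ge0 c_gt0) => n.
pose f := \prod_k g k ^+ m n k.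
have fE w : cmod f.[w] = \prod_k cmod (g k).[w] ^+ m n k.
  rewrite horner_prod cmod_prod; apply: eq_bigr => k _.
  by rewrite horner_exp cmodX.
have f_circle w : cmod w = r -> cmod f.[w] <= (\prod_k B k) * S ^+ n.
  move=> wr; rewrite fE.
  apply: le_trans (ler_wpM2l _ (lerXn2r n _ _ (gS w wr))); last 3 first.
  - by apply: prodr_ge0 => k _; apply: le_trans (B_ge1 k).
  - by apply: prodr_ge0 => k _; apply: powR_ge0.
  - by [].
  rewrite prodE -big_split /=; apply: ler_prod => k _.
  rewrite exprn_ge0 ?cmod_ge0 //=.
  have /andP[_ /le_trans] := powR_next_nat (cmod_ge0 (g k).[w]) (na_ge0 n k).
  apply; rewrite ler_wpM2r ?powR_ge0 //.
  by rewrite ge_max B_ge1 gB.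
(* Transfer to [R[i]], where [horner_disc_bound] is stated, and back to [R]. *)
have := horner_disc_bound (C := R[i]) (f := f) (r := r%:C%C) (w0 := w0)
  (M := ((\prod_k B k) * S ^+ n)%:C%C).
rewrite normE ltcR w0r -fmorph_div -(rmorph1 (real_complex R)) -rmorphB /=.
rewrite normE -rmorphM lecR => /(_ isT) f_disc.
apply: le_trans (f_disc _); last first.
  by move=> w; rewrite !normE lecR => /complexI/f_circle.
rewrite /c -mulrA [leLHS]mulrC ler_wpM2r ?(ltW w0r1) // fE /V.
rewrite prodE -big_split /=.
apply: ler_prod => k _.
have /andP[-> _] := powR_next_nat (cmod_ge0 (g k).[w0]) (na_ge0 n k).
by rewrite mulr_ge0 ?powR_ge0 // le_min ler01 cmod_ge0.
Qed.

End MaximumPrinciple.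

(** The power [t `^ a] lies above its logarithmic minorant [1 + a ln t], and
    [ln t >= 1 - 1 / t]; hence [a <= t * s] for every [t > 1]. *)
Lemma powR_tangent (R : realType) (a s : R) : 0 <= a ->
  (forall t, 1 < t -> t `^ a <= 1 + (t - 1) * s) -> a <= s.
Proof.
move=> a_ge0 ts; have ats t : 1 < t -> a <= t * s.
  move=> t1; have t_gt0 : 0 < t by apply: lt_trans t1.
  have ln_ge : 1 - t^-1 <= ln t.
    have := @le_ln1Dx R (t^-1 - 1); rewrite addrCA subrr addr0 lnV ?posrE //.
    by rewrite ltrBrDl subrr invr_gt0 => /(_ t_gt0); rewrite lerNl opprB.
  have at1 : a * (1 - t^-1) <= (t - 1) * s.
    have := ts t t1; rewrite /powR (gt_eqF t_gt0).
    move=> /(le_trans (expR_ge1Dx (a * ln t))); rewrite lerD2l; apply: le_trans.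
    by rewrite ler_wpM2l.
  have t1_gt0 : 0 < t - 1 by rewrite subr_gt0.
  have atE : a * (1 - t^-1) = (t - 1) * (a / t) by field; rewrite gt_eqF.
  by move: at1; rewrite atE ler_pM2l // ler_pdivrMr // mulrC.
rewrite leNgt; apply/negP => sa.
pose e := (a - s) / (`|s| + 1).
have s1 : 0 < `|s| + 1 by rewrite ltr_wpDl.
have e_gt0 : 0 < e by rewrite divr_gt0 // subr_gt0.
have := ats (1 + e); rewrite ltrDl => /(_ e_gt0).
have : e * `|s| + e = a - s.
  by rewrite -[X in _ + X]mulr1 -mulrDr mulfVK // gt_eqF.
have := ler_wpM2l (ltW e_gt0) (ler_norm s).
lra.
Qed.

(** * Evaluation of multivariate polynomials *)

Lemma exists_nonroot (F : numDomainType) (q : {poly F}) :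
  q != 0 -> exists t, q.[t] != 0.
Proof.
move=> q0; pose rs := [seq (i : nat)%:R : F | i <- iota 0 (size q)].
have rs_uniq : uniq rs.
  by rewrite map_inj_uniq ?iota_uniq // => i j /eqP; rewrite eqr_nat => /eqP.
have [/(max_poly_roots q0)/(_ rs_uniq)|] := boolP (all (root q) rs).
  by rewrite size_map size_iota ltnn.
by rewrite -has_predC => /hasP[t _ qt]; exists t.
Qed.

(** Induction on the number of variables: as a polynomial in its last variable,
    [P] has a nonzero coefficient, which is nonzero at some point [v] by
    induction; specializing the other variables to [v] leaves a nonzero
    univariate polynomial. *)
Lemma exists_mpoly_nonroot (F : numDomainType) (n : nat) (P : {mpoly F[n]}) :
  P != 0 -> exists v, P.@[v] != 0.
Proof.
elim: n P => [|n IHn] P P0.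
  exists (fun=> 0); move: P0; rewrite [P]nvar0_mpolyC mevalC.
  by rewrite mpolyC_eq0.
pose rest (m : 'X_{1..n.+1}) : 'X_{1..n} :=
  [multinom m (widen_ord (leqnSn n) i) | i < n].
have [m0 m0P] : exists m0, m0 \in msupp P.
  case E : (msupp P) => [|m s]; last by exists m; rewrite mem_head.
  by move: P0; rewrite -msupp_eq0 E eqxx.
(* A monomial is determined by its last exponent and the remaining ones, so
   [m0] alone contributes to the coefficient examined here. *)
have muniP0 : (muni P)`_(m0 ord_max) != 0.
  apply/eqP => /(congr1 (mcoeff (rest m0))); rewrite mcoeff0 muniE coef_sum.
  rewrite raddf_sum /= (bigD1_seq m0) ?msupp_uniq //= big1 => [|m mm0].
    rewrite addr0 coefZ coefXn eqxx mulr1 mcoeffZ mcoeffX eqxx mulr1.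
    by apply/eqP; rewrite -mcoeff_msupp.
  rewrite coefZ coefXn; have [mmax|_] := eqVneq; last by rewrite mulr0 mcoeff0.
  rewrite mulr1 mcoeffZ mcoeffX.
  have [mrest|_] := eqVneq; last by rewrite mulr0.
  case/eqP: mm0; apply/mnmP => i.
  have [j ->|->] := unliftP ord_max i; last by rewrite mmax.
  have -> : lift ord_max j = widen_ord (leqnSn n) j.
    by apply: val_inj; rewrite /= /bump leqNgt ltn_ord add0n.
  by have := congr1 (fun m : 'X_{1..n} => m j) mrest; rewrite !mnmE.
have [v vP] := IHn _ muniP0.
have [|t tP] := @exists_nonroot F (map_poly (meval v) (muni P)).
  apply: contra vP => /eqP/(congr1 (coefp (m0 ord_max))) /=.
  by rewrite coef_map /= coef0 => ->.
exists (fun i => if unlift ord_max i is Some j then v j else t).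
move: tP; apply: contra => /eqP Pv; apply/eqP; rewrite -[RHS]Pv mevalE muniE.
rewrite raddf_sum horner_sum; apply: eq_bigr => m _ /=.
rewrite -mul_polyC rmorphM /= map_polyXn map_polyC /= mevalZ mevalX.
rewrite hornerM hornerC hornerXn -mulrA big_ord_recr /= unlift_none.
congr (_ * (_ * _)).
apply: eq_bigr => i _; rewrite mnmE.
have -> : widen_ord (leqnSn n) i = lift ord_max i.
  by apply: val_inj; rewrite /= /bump leqNgt ltn_ord add0n.
by rewrite liftK.
Qed.

Lemma meval_homogZ (F : comNzRingType) (n : nat) (P : {mpoly F[n]})
    (v : 'I_n -> F) (c : F) :
  P \is homog mdeg -> P.@[fun i => c * v i] = c ^+ (msize P).-1 * P.@[v].
Proof.
rewrite homog_msize => /dhomogP homP; rewrite !mevalE mulr_sumr.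
apply: eq_big_seq => m /homP <-.
rewrite mulrCA; congr (_ * _); rewrite [X in _ ^+ X]mdegE.
rewrite -prodrXr -big_split /=.
by apply: eq_bigr => i _; rewrite exprMn.
Qed.

Definition line_poly (F : comNzRingType) (n : nat) (P : {mpoly F[n]})
    (u e : 'I_n -> F) : {poly F} :=
  mmap polyC (fun i => (u i)%:P + (e i) *: 'X) P.

Lemma horner_line_poly (F : comNzRingType) (n : nat) (P : {mpoly F[n]})
    (u e : 'I_n -> F) (w : F) :
  (line_poly P u e).[w] = P.@[fun i => u i + w * e i].
Proof.
rewrite mevalE /line_poly /mmap horner_sum; apply: eq_bigr => m _.
rewrite hornerM hornerC; congr (_ * _); rewrite horner_prod.
by apply: eq_bigr => i _; rewrite horner_exp !hornerE mulrC.
Qed.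

(** * Angles and the Hermitian product *)

(** Both angles lie between [0] and [pi], where [cos] decreases, and their
    cosines are [sqrt (1 - s ^+ 2)] and [x]. *)
Lemma asin_le_acos (R : realType) (s x : R) :
  0 <= s -> s ^+ 2 <= 1 - x ^+ 2 -> asin s <= acos x.
Proof.
move=> s_ge0 sx.
have x2 : x ^+ 2 <= 1 by have := sqr_ge0 s; lra.
have s2 : s ^+ 2 <= 1 by have := sqr_ge0 x; lra.
have x1 : -1 <= x <= 1.
  by rewrite -ler_norml -(expr_le1 (n := 2)) // real_normK ?num_real.
have s1 : -1 <= s <= 1.
  by rewrite -ler_norml -(expr_le1 (n := 2)) // real_normK ?num_real.
have pi0 := pi_ge0 R.
have asin_itv : asin s \in `[0, pi].
  rewrite in_itv /=; apply/andP; split; last first.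
    by apply: le_trans (asin_lepi2 s1) _; lra.
  rewrite leNgt; apply/negP => asin_lt0.
  have : 0 < sin (- asin s).
    by apply: sin_gt0_pi; have := asin_geNpi2 s1; have := pi_gt0 R; lra.
  by rewrite sinN asinK ?in_itv //= oppr_gt0 ltNge s_ge0.
have acos_itv : acos x \in `[0, pi].
  by rewrite in_itv /= acos_ge0 // acos_lepi.
rewrite leNgt -(ltr_cos acos_itv asin_itv) -leNgt acosK ?in_itv //=.
rewrite cos_asin // (le_trans (ler_norm x)) // -sqrtr_sqr ler_wsqrtr //.
lra.
Qed.

Section Hermitian.
Variables (R : realType) (d : nat).
Implicit Types u v w : 'rV[R[i]]_d.

Definition hdot u v : R[i] := \sum_(j < d) u 0 j * conjc (v 0 j).

Definition sqnorm u : R := \sum_(j < d) cmod (u 0 j) ^+ 2.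

Lemma hdotDl u v w : hdot (u + v) w = hdot u w + hdot v w.
Proof. by rewrite -big_split; apply: eq_bigr => j _; rewrite mxE mulrDl. Qed.

Lemma hdotZl a u v : hdot (a *: u) v = a * hdot u v.
Proof. by rewrite mulr_sumr; apply: eq_bigr => j _; rewrite mxE mulrA. Qed.

Lemma hdotC u v : hdot u v = conjc (hdot v u).
Proof.
rewrite rmorph_sum; apply: eq_bigr => j _.
by rewrite rmorphM /= conjcK mulrC.
Qed.

Lemma hdotDr u v w : hdot u (v + w) = hdot u v + hdot u w.
Proof. by rewrite hdotC hdotDl rmorphD /= -!hdotC. Qed.

Lemma hdotZr a u v : hdot u (a *: v) = conjc a * hdot u v.
Proof. by rewrite hdotC hdotZl rmorphM /= -hdotC. Qed.

Lemma hdotxx u : hdot u u = (sqnorm u)%:C%C.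
Proof. by rewrite rmorph_sum; apply: eq_bigr => j _; rewrite /= cmod_sqr. Qed.

Lemma sqnorm_ge0 u : 0 <= sqnorm u.
Proof. by apply: sumr_ge0 => j _; rewrite exprn_ge0 ?cmod_ge0. Qed.

Lemma sqnormZ a u : sqnorm (a *: u) = cmod a ^+ 2 * sqnorm u.
Proof.
rewrite mulr_sumr; apply: eq_bigr => j _.
by rewrite mxE Normc.normcM exprMn.
Qed.

Lemma sqnorm_orthogonal u v (a b : R[i]) : hdot u v = 0 ->
  sqnorm (a *: u + b *: v) = cmod a ^+ 2 * sqnorm u + cmod b ^+ 2 * sqnorm v.
Proof.
move=> uv; apply: complexI; rewrite -hdotxx rmorphD.
rewrite (rmorphM _ (cmod a ^+ 2)) (rmorphM _ (cmod b ^+ 2)) /=.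
rewrite !cmod_sqr -!hdotxx.
have vu : hdot v u = 0 by rewrite hdotC uv conjc0.
by rewrite !(hdotDl, hdotDr) !hdotZl !hdotZr uv vu; ring.
Qed.

Lemma orthogonal_residual p q : sqnorm q = 1 ->
  hdot q (p - hdot p q *: q) = 0.
Proof.
move=> q1; rewrite -scaleNr hdotDr hdotZr hdotxx q1 rmorphN /= -hdotC mulr1.
by rewrite subrr.
Qed.

Lemma sqnorm_residual p q : sqnorm p = 1 -> sqnorm q = 1 ->
  sqnorm (p - hdot p q *: q) = 1 - cmod (hdot p q) ^+ 2.
Proof.
move=> p1 q1.
have := sqnorm_orthogonal (hdot p q) 1 (orthogonal_residual p q1).
rewrite scale1r addrC subrK p1 q1 Normc.normc1; lra.
Qed.

End Hermitian.

(** * The weighted modulus along a complex line *)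

Section WeightedModulus.
Variables (R : realType) (d N : nat).
Variables (P : 'I_N -> {mpoly R[i][d]}) (delta : 'I_N -> R).
Hypothesis hd : (1 <= d)%N.
Hypothesis P_neq0 : forall k, P k != 0.
Hypothesis P_homog : forall k, P k \is homog mdeg.
Hypothesis delta_gt0 : forall k, 0 < delta k.

Let D : R := \sum_(k < N) delta k ^+ 2 * (total_degree (P k))%:R.

Lemma weighted_modulusZ (a : R) (z : 'rV[R[i]]_d) : 0 < a ->
  weighted_modulus P delta (a%:C%C *: z) = a `^ D * weighted_modulus P delta z.
Proof.
move=> a_gt0; have a_neq0 : a != 0 by rewrite gt_eqF.
have -> : a `^ D = \prod_(k < N) (a ^+ total_degree (P k)) `^ (delta k ^+ 2).
  rewrite /D; elim/big_ind2 : _ => [|x1 x2 y1 y2 <- <-|k _].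
  - by rewrite powRr0.
  - by rewrite powRD ?a_neq0 ?implybT.
  by rewrite mulrC powRrM powR_mulrn // ltW.
rewrite -big_split /=; apply: eq_bigr => k _.
have -> : (P k).@[(a%:C%C *: z) 0] = (P k).@[fun j => a%:C%C * z 0 j].
  by apply: meval_eq => j; rewrite mxE.
rewrite meval_homogZ // Normc.normcM cmodX cmod_real gtr0_norm //.
by rewrite powRM ?cmod_ge0 ?exprn_ge0 ?ltW.
Qed.

Variable p : 'rV[R[i]]_d.
Hypothesis p_max :
  attains_max_on (weighted_modulus P delta) (@unit_sphere R d) p.

Lemma weighted_modulus_le_max (z : 'rV[R[i]]_d) : 0 < sqnorm z ->
  weighted_modulus P delta z
    <= Num.sqrt (sqnorm z) `^ D * weighted_modulus P delta p.
Proof.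
move=> z_gt0; set s := Num.sqrt _.
have s_gt0 : 0 < s by rewrite sqrtr_gt0.
pose z1 := (s^-1)%:C%C *: z.
have zE : z = s%:C%C *: z1.
  by rewrite scalerA -rmorphM divff ?gt_eqF // scale1r.
rewrite [in leLHS]zE (weighted_modulusZ z1 s_gt0).
apply: ler_wpM2l; first exact: powR_ge0.
apply: p_max.2; rewrite /unit_sphere /= -/(sqnorm _) sqnormZ cmod_real.
rewrite real_normK ?num_real // exprVn sqr_sqrtr; last exact: ltW.
by rewrite mulVf // gt_eqF.
Qed.

(** The product of the [P k] is not identically zero; the extra factor, a
    coordinate function, ensures that the point found is not the origin and can
    be scaled to the sphere. *)
Lemma weighted_modulus_max_gt0 : 0 < weighted_modulus P delta p.
Proof.
have : (\prod_k P k) * 'X_(Ordinal hd) != 0.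
  apply: mulf_neq0; first by apply/prodf_neq0 => k _; apply: P_neq0.
  by rewrite -msize_poly_eq0 msizeX.
case/exists_mpoly_nonroot => v; rewrite mevalM mevalXU rmorph_prod /=.
rewrite mulf_eq0 negb_or => /andP[/prodf_neq0 Pv v0].
pose z : 'rV[R[i]]_d := \row_j v j.
have z_gt0 : 0 < sqnorm z.
  rewrite lt0r sqnorm_ge0 andbT psumr_neq0; last first.
    by move=> j _; rewrite exprn_ge0 ?cmod_ge0.
  apply/hasP; exists (Ordinal hd); rewrite ?mem_index_enum //= mxE.
  by rewrite exprn_gt0 // lt0r cmod_eq0 v0 cmod_ge0.
have Wz : 0 < weighted_modulus P delta z.
  apply: prodr_gt0 => k _; apply: powR_gt0.
  rewrite lt0r cmod_ge0 andbT cmod_eq0.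
  have -> : (P k).@[z 0] = (P k).@[v] by apply: meval_eq => j; rewrite mxE.
  exact: Pv.
have := lt_le_trans Wz (weighted_modulus_le_max z_gt0).
by rewrite pmulr_rgt0 // powR_gt0 // sqrtr_gt0.
Qed.

Hypothesis D_le1 : D <= 1.

(** On the complex line through [c q] and [p], the factor [w] split off from
    [P k] grows like [|w|] while the other factors satisfy the maximum
    principle; beyond [p] the weighted modulus would exceed its maximum if this
    growth, with exponent [delta k ^+ 2], outran that of the norm. *)
Lemma delta_sqr_le (k : 'I_N) (q : 'rV[R[i]]_d) :
    unit_sphere q -> zero_set (P k) q ->
  delta k ^+ 2 <= 1 - cmod (hdot p q) ^+ 2.
Proof.
move=> q1 Pq0; have p1 : sqnorm p = 1 := p_max.1.
have {}q1 : sqnorm q = 1 := q1.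
set c := hdot p q; pose e := p - c *: q; set s := 1 - _.
have s_ge0 : 0 <= s by rewrite /s /c -(sqnorm_residual p1 q1) sqnorm_ge0.
pose f j := line_poly (P j) ((c *: q) 0) (e 0).
have fE j w : (f j).[w] = (P j).@[(c *: q + w *: e) 0].
  by rewrite horner_line_poly; apply: meval_eq => i; rewrite !mxE.
have /factor_theorem[g fg] : root (f k) 0.
  rewrite rootE fE scale0r addr0.
  have -> : (P k).@[(c *: q) 0] = (P k).@[fun j => c * q 0 j].
    by apply: meval_eq => i; rewrite mxE.
  by rewrite meval_homogZ // Pq0 mulr0.
rewrite subr0 in fg.
pose h j := if j == k then g else f j.
have WE w : weighted_modulus P delta (c *: q + w *: e)
          = cmod w `^ (delta k ^+ 2) * \prod_j cmod (h j).[w] `^ (delta j ^+ 2).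
  rewrite /weighted_modulus (bigD1 k) //= [in RHS](bigD1 k) //= mulrA.
  congr (_ * _); last first.
    by apply: eq_bigr => j /negPf jk; rewrite /h jk fE.
  rewrite -fE fg /h eqxx hornerMX Normc.normcM powRM ?cmod_ge0 //.
  by rewrite mulrC.
have Wp : \prod_j cmod (h j).[1] `^ (delta j ^+ 2) = weighted_modulus P delta p.
  have := WE 1; rewrite Normc.normc1 powR1 mul1r => <-.
  by rewrite scale1r addrC subrK.
have norm_line w : sqnorm (c *: q + w *: e) = 1 + (cmod w ^+ 2 - 1) * s.
  rewrite sqnorm_orthogonal ?orthogonal_residual // q1 sqnorm_residual //.
  by rewrite -/c -/s /s; ring.
apply: powR_tangent => [|t t_gt1]; first by rewrite exprn_ge0 // ltW.
pose r := Num.sqrt t.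
have t_ge0 : 0 <= t by lra.
have r2 : r ^+ 2 = t by rewrite sqr_sqrtr.
have r_gt1 : 1 < r by rewrite -sqrtr1 ltr_sqrt; lra.
have r_gt0 : 0 < r by lra.
set n := 1 + (t - 1) * s.
have n_ge1 : 1 <= n by rewrite lerDl mulr_ge0 //; lra.
have n_gt0 : 0 < n by lra.
have : weighted_modulus P delta p
     <= Num.sqrt n `^ D * weighted_modulus P delta p / r `^ (delta k ^+ 2).
  rewrite -[leLHS]Wp; apply: (max_principle_prod_powR (r := r)).
  - by move=> j; rewrite exprn_gt0.
  - by rewrite Normc.normc1.
  move=> w wr; rewrite ler_pdivlMr ?powR_gt0 // mulrC -[in leLHS]wr -WE.
  have := @weighted_modulus_le_max (c *: q + w *: e).
  by rewrite norm_line wr r2 -/n; apply.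
have W_gt0 := weighted_modulus_max_gt0.
rewrite mulrAC -[leLHS]mul1r ler_pM2r // ler_pdivlMr ?powR_gt0 // mul1r => rn.
have {}rn : r `^ (delta k ^+ 2) <= Num.sqrt n.
  by apply: le_trans rn (ler1_powR _ D_le1); rewrite -sqrtr1 ler_wsqrtr.
rewrite -r2 expr2 powRM ?(ltW r_gt0) // -expr2 -(sqr_sqrtr (ltW n_gt0)).
by rewrite lerXn2r ?nnegrE ?powR_ge0 ?sqrtr_ge0.
Qed.

End WeightedModulus.

Theorem theorem1p10 (R : realType) (d N : nat)
    (hd : (1 <= d)%N) (hN : (1 <= N)%N)
    (P : 'I_N -> {mpoly R[i][d]}) (delta : 'I_N -> R)
    (hP0 : forall k, P k != 0)
    (hPhom : forall k, P k \is homog mdeg)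
    (hdelta : forall k, 0 < delta k)
    (hsum : \sum_(k < N) delta k ^+ 2 * (total_degree (P k))%:R <= 1)
    (p : 'rV[R[i]]_d)
    (hp : attains_max_on (weighted_modulus P delta) (@unit_sphere R d) p) :
  forall k : 'I_N,
    angular_distance_ge (asin (delta k)) p
      (zero_set (P k) `&` @unit_sphere R d).
Proof.
move=> k z [Pz0 z1]; apply: asin_le_acos; first exact: ltW.
apply: le_trans (delta_sqr_le hd hP0 hPhom hdelta hp hsum z1 Pz0) _.
rewrite lerD2l lerN2 -/(hdot p z); case: (hdot p z) => a b /=.
by rewrite sqr_sqrtr ?addr_ge0 ?sqr_ge0 // lerDl sqr_ge0.
Qed.
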